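(* Let $m\ge 1$ be an integer, let $t_0<t_f<\infty$ be real numbers, let $\mathbf{x}^0=(x_1^0,\ldots,x_m^0)\in\mathbb{R}^m$, and let $f_1,\ldots,f_m:[t_0,t_f]\times\mathbb{R}^m\to\mathbb{R}$ be continuous functions which have first and second order partial derivatives with respect to the variables $x_1,\ldots,x_m$. Suppose that there exists $L>0$ such that for every $i\in\{1,\ldots,m\}$ $$|f_i(t,\mathbf{x})-f_i(t,\mathbf{y})|\le L\sum_{j=1}^m|x_j-y_j|\qquad\text{for all } t\in[t_0,t_f],\ \mathbf{x},\mathbf{y}\in\mathbb{R}^m .$$ Let $\mathbf{x}(t)=(x_1(t),\ldots,x_m(t))$ be the solution on $[t_0,t_f]$ of the initial value problem $$x_i'(t)=f_i(t,x_1(t),\ldots,x_m(t)),\qquad x_i(t_0)=x_i^0,\qquad i\in\{1,\ldots,m\}.$$ Let $(\mathbf{u}_n)_{n\in\mathbb{N}}$, $\mathbf{u}_n=(u_{n,1},\ldots,u_{n,m}):[t_0,t_f]\to\mathbb{R}^m$, be the variational iteration sequence, that is, a sequence of continuously differentiable functions with $u_{n,i}(t_0)=x_i^0$ for all $n\in\mathbb{N}$ and $i\in\{1,\ldots,m\}$, such that $$u_{n+1,i}(t)=u_{n,i}(t)+\int_{t_0}^t\lambda_{n,i}(s,t)\left(u_{n,i}'(s)-f_i(s,\mathbf{u}_n(s))\right)\mathrm{d}s$$ for all $n\in\mathbb{N}$, $i\in\{1,\ldots,m\}$ and $t\in[t_0,t_f]$, where $$\lambda_{n,i}(s,t)=-\exp\left(\int_s^t\frac{\partial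 f_i}{\partial x_i}(\tau,\mathbf{u}_n(\tau))\,\mathrm{d}\tau\right),\qquad t_0\le s\le t\le t_f .$$ Then $(\mathbf{u}_n)_{n\in\mathbb{N}}$ converges uniformly on $[t_0,t_f]$ to $\mathbf{x}$, i.e. $\lim_{n\to\infty}\|\mathbf{u}_n-\mathbf{x}\|_\infty=0$.
   Context: For $\mathbf{v}=(v_1,\ldots,v_m)\in\mathbb{R}^m$, $\|\mathbf{v}\|_1=\sum_{j=1}^m|v_j|$. For a continuous function $\mathbf{v}:[t_0,t_f]\to\mathbb{R}^m$, $\|\mathbf{v}\|_\infty=\max_{t_0\le t\le t_f}\|\mathbf{v}(t)\|_1$. $\frac{\partial f_i}{\partial x_i}$ denotes the partial derivative of $f_i(t,x_1,\ldots,x_m)$ with respect to $x_i$. The function $s\mapsto\lambda_{n,i}(s,t)$ (the Lagrange multiplier attached to the $i$-th equation) is the solution on $[t_0,t]$ of $\lambda'(s)=-\frac{\partial f_i}{\partial x_i}(s,\mathbf{u}_n(s))\lambda(s)$, $\lambda(t)=-1$. The initial function $\mathbf{u}_0$ is arbitrary subject to the stated requirements (continuously differentiable, $\mathbf{u}_0(t_0)=\mathbf{x}^0$). *)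

(* Defs.v *)
From HB Require Import structures.
From mathcomp Require Import all_boot all_order all_algebra.
From mathcomp Require Import all_classical all_reals all_analysis.

Set Implicit Arguments.
Unset Strict Implicit.
Unset Printing Implicit Defensive.

Import Order.TTheory GRing.Theory Num.Theory.
Import numFieldNormedType.Exports.

Local Open Scope classical_set_scope.
Local Open Scope ring_scope.

Definition norm1 (R : realType) (m : nat) (v : 'rV[R]_m) : R :=
  \sum_(j < m) `|v 0 j|.

(* [sup] is a real number; the supremum is a maximum when [v] is continuous on
   [a, b], which is the only case in which this norm is meant to be used. *)
Definition norm_sup (R : realType) (m : nat) (a b : R) (v : R -> 'rV[R]_m) : R :=
  sup [set norm1 (v t) | t in `[a, b]].

(* Derivative of a function on [a, b]: the difference quotients only involve
   points of [a, b], so the derivative is one-sided at a and at b, and values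
   taken outside [a, b] are irrelevant. *)
Definition diff_quot (R : realType) (g : R -> R) (t s : R) : R :=
  (g s - g t) / (s - t).

Definition derivable_on (R : realType) (a b : R) (g : R -> R) : Prop :=
  forall t : R, t \in `[a, b] -> cvg (diff_quot g t @ within `[a, b] t^').

Definition derive_on (R : realType) (a b : R) (g : R -> R) (t : R) : R :=
  lim (diff_quot g t @ within `[a, b] t^').

Definition C1_on (R : realType) (a b : R) (g : R -> R) : Prop :=
  derivable_on a b g /\ {within `[a, b], continuous (derive_on a b g)}.

Definition basis_vec (R : realType) (m : nat) (j : 'I_m) : 'rV[R]_m :=
  delta_mx 0 j.

Definition has_partial (R : realType) (m : nat) (j : 'I_m)
    (g : 'rV[R]_m -> R) : Prop :=
  forall x, derivable g x (basis_vec R j).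

Definition partial (R : realType) (m : nat) (j : 'I_m)
    (g : 'rV[R]_m -> R) (x : 'rV[R]_m) : R :=
  'D_(basis_vec R j) g x.

(* Integrals are Lebesgue integrals: the partial derivatives are not assumed
   to be continuous, so the inner integrand need not be Riemann integrable; it
   is measurable (a limit of continuous difference quotients), and it is
   bounded when f is Lipschitz in x. *)
Definition multiplier (R : realType) (m : nat) (f : 'I_m -> R -> 'rV[R]_m -> R)
    (u : R -> 'rV[R]_m) (i : 'I_m) (s t : R) : R :=
  - expR (\int[lebesgue_measure]_(tau in `[s, t]) partial i (f i tau) (u tau)).

(* Main.v *)
(** Write [e_n = u_n - x] and [A_i(s) = \int_s^t alpha_i] with
    [alpha_i(s) = (df_i/dx_i)(s, u_n(s))]. Integrating by parts against the
    multiplier [- exp (A_i s)] cancels [e_(n,i)(t)] in the recursion and leaves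
    [e_(n+1,i)(t) = \int_t0^t exp (A_i s)
       (f_i(s, u_n s) - f_i(s, x s) - alpha_i(s) e_(n,i)(s)) ds],
    an expression without derivatives, bounded by [C \int_t0^t |e_n|_1] because
    [|alpha_i| <= L]. In the weighted norm [sup_t |v t|_1 exp (- beta (t - t0))]
    with [beta = 2 m C] each step halves the error.

    As [alpha_i] is merely bounded and measurable, [exp (A_i s)] is only
    Lipschitz. The product and chain rules for Lipschitz indefinite integrals
    are obtained without differentiating almost everywhere: if [G t - G s]
    equals [\int_s^t g] up to [K (t - s)^2] for all [s <= t], then equality
    holds, by subdividing. *)
Require Import Defs.
From HB Require Import structures.
From mathcomp Require Import all_boot all_order all_algebra.
From mathcomp Require Import all_classical all_reals all_analysis.
From mathcomp Require Import measurable_realfun ring lra.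

Set Implicit Arguments.
Unset Strict Implicit.
Unset Printing Implicit Defensive.

Import Order.TTheory GRing.Theory Num.Theory.
Import numFieldNormedType.Exports.

Local Open Scope classical_set_scope.
Local Open Scope ring_scope.

(** * Bounded measurable functions on an interval and their integrals *)

Section bounded_measurable.
Context {R : realType}.
Notation mu := (@lebesgue_measure R).
Implicit Types (a b c s t K : R) (f g F G : R -> R).

(** The class contains the continuous functions, is closed under sums, products and [expR], and
    consists of integrable functions, so integrability conditions reduce to membership. *)
Definition bounded_measurable a b f :=
  measurable_fun `[a, b] f /\
  exists2 K, 0 <= K & {in `[a, b], forall s, `|f s| <= K}.

Lemma bounded_measurableS a b s t f : a <= s -> t <= b ->
  bounded_measurable a b f -> bounded_measurable s t f.
Proof.
move=> as_ tb [mf [K K0 fK]].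
have sub : `[s, t] `<=` `[a, b].
  by move=> r /=; rewrite !in_itv/= => /andP[sr rt]; apply/andP; split; lra.
split; first exact: measurable_funS mf.
by exists K => // r /sub; exact: fK.
Qed.

Lemma bounded_measurable_integrable a b f :
  bounded_measurable a b f -> mu.-integrable `[a, b] (EFin \o f).
Proof.
move=> [mf [K K0 fK]]; apply: measurable_bounded_integrable => //.
- by rewrite /= lebesgue_measure_itv/= lte_fin; case: ifPn => // ?; rewrite ltry.
- exists K; split; first exact: num_real.
  by move=> M KM r /= /fK /le_trans; apply; exact: ltW.
Qed.

Lemma bounded_measurable_cst a b c : bounded_measurable a b (cst c).
Proof. by split => //; exists `|c|. Qed.

Lemma bounded_measurableD a b f g : bounded_measurable a b f ->
  bounded_measurable a b g -> bounded_measurable a b (fun s => f s + g s).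
Proof.
move=> [mf [K K0 fK]] [mg [M M0 gM]]; split; first exact: measurable_funD.
exists (K + M) => [|s sab]; first exact: addr_ge0.
by rewrite (le_trans (ler_normD _ _))// lerD ?fK ?gM.
Qed.

Lemma bounded_measurableN a b f : bounded_measurable a b f ->
  bounded_measurable a b (fun s => - f s).
Proof.
move=> [mf [K K0 fK]]; split; first exact: measurableT_comp.
by exists K => // s sab; rewrite normrN fK.
Qed.

Lemma bounded_measurableB a b f g : bounded_measurable a b f ->
  bounded_measurable a b g -> bounded_measurable a b (fun s => f s - g s).
Proof.
by move=> bf bg; apply: bounded_measurableD => //; exact: bounded_measurableN.
Qed.

Lemma bounded_measurableM a b f g : bounded_measurable a b f ->
  bounded_measurable a b g -> bounded_measurable a b (fun s => f s * g s).
Proof.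
move=> [mf [K K0 fK]] [mg [M M0 gM]]; split; first exact: measurable_funM.
exists (K * M) => [|s sab]; first exact: mulr_ge0.
by rewrite normrM ler_pM ?fK ?gM.
Qed.

Lemma bounded_measurable_norm a b f : bounded_measurable a b f ->
  bounded_measurable a b (fun s => `|f s|).
Proof.
move=> [mf [K K0 fK]]; split; first exact: measurableT_comp.
by exists K => // s sab; rewrite normr_id fK.
Qed.

Lemma bounded_measurable_expR a b f : bounded_measurable a b f ->
  bounded_measurable a b (fun s => expR (f s)).
Proof.
move=> [mf [K K0 fK]]; split; first exact: measurableT_comp.
exists (expR K) => [|s sab]; first exact: expR_ge0.
by rewrite ger0_norm ?expR_ge0// ler_expR (le_trans (ler_norm _))// fK.
Qed.

Lemma bounded_measurable_sum (I : Type) (r : seq I) a b (F : I -> R -> R) :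
  (forall i, bounded_measurable a b (F i)) ->
  bounded_measurable a b (fun s => \sum_(i <- r) F i s).
Proof.
move=> bF; elim: r => [|i r ih].
  rewrite (_ : (fun _ => _) = cst 0); first exact: bounded_measurable_cst.
  by apply/funext => s; rewrite big_nil.
rewrite (_ : (fun _ => _) = fun s => F i s + \sum_(i <- r) F i s).
  exact: bounded_measurableD.
by apply/funext => s; rewrite big_cons.
Qed.

Lemma continuous_bounded_measurable a b f :
  {within `[a, b], continuous f} -> bounded_measurable a b f.
Proof.
move=> cf; split; first exact: subspace_continuous_measurable_fun.
have [ab|ba] := leP a b; last first.
  exists 0 => // s; rewrite in_itv/= => /andP[? ?]; exfalso; lra.
have cnf : {within `[a, b], continuous (fun s => `|f s|)}.
  by move=> s; apply: cvg_norm; exact: cf.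
have [c cab cmax] := EVT_max ab cnf.
by exists `|f c|.
Qed.

Lemma Rintegral_split a b c f : a <= c <= b -> bounded_measurable a b f ->
  \int[mu]_(x in `[a, b]) f x =
    \int[mu]_(x in `[a, c]) f x + \int[mu]_(x in `[c, b]) f x.
Proof.
move=> /andP[ac cb] bf; have := @Rintegral_itvB _ f (BLeft a) (BRight b) c.
move=> /(_ (bounded_measurable_integrable bf)); rewrite !bnd_simp.
(* The point [c] has measure zero, so the half-open piece ]c, b] may be closed. *)
rewrite Rintegral_itv_obnd_cbnd; last first.
  apply: integrableS (bounded_measurable_integrable bf) => //.
  by move=> r /=; rewrite !in_itv/= => /andP[? ?]; apply/andP; split; lra.
by move=> <- //; rewrite addrC subrK.
Qed.

Lemma le_norm_Rintegral_itv a b f K : a <= b -> bounded_measurable a b f ->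
  {in `[a, b], forall s, `|f s| <= K} ->
  `|\int[mu]_(x in `[a, b]) f x| <= K * (b - a).
Proof.
move=> ab bf fK.
have := le_normr_Rintegral _ (bounded_measurable_integrable bf).
move=> /(_ (measurable_itv _))/le_trans; apply.
apply: (@le_trans _ _ (\int[mu]_(x in `[a, b]) K)).
  apply: le_Rintegral => //; try apply: bounded_measurable_integrable.
  - exact: bounded_measurable_norm.
  - exact: bounded_measurable_cst.
rewrite Rintegral_cst//= lebesgue_measure_itv/= lte_fin.
by have [//|ba] := ltP; rewrite (_ : b - a = 0)// ; lra.
Qed.

End bounded_measurable.

(** * Lipschitz indefinite integrals, recognized by quadratic errors *)

Section primitive.
Context {R : realType}.
Notation mu := (@lebesgue_measure R).
Implicit Types (a b c s t K : R) (f g F G : R -> R).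

(** Cutting [a, b] into n equal pieces bounds the total increment by n times K ((b - a) / n)^2,
    which tends to 0. *)
Lemma quadratic_increments_eq a b K F : a <= b ->
  (forall s t, a <= s -> s <= t -> t <= b -> `|F t - F s| <= K * (t - s) ^+ 2) ->
  F a = F b.
Proof.
move=> ab FK; apply/eqP; rewrite eq_sym -subr_eq0 -normr_eq0.
rewrite eq_le normr_ge0 andbT; apply/ler_addgt0Pl => e e0; rewrite addr0.
have sumle n : (0 < n)%N -> `|F b - F a| <= K * (b - a) ^+ 2 / n%:R.
  move=> n0; have nR0 : 0 < n%:R :> R by rewrite ltr0n.
  pose h := (b - a) / n%:R; have h0 : 0 <= h by rewrite divr_ge0// subr_ge0.
  pose p (k : nat) := a + h *+ k.
  have pn : p n = b.
    by rewrite /p -mulr_natr /h divfK ?gt_eqF// addrC subrK.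
  have -> : F b - F a = \sum_(0 <= k < n) (F (p k.+1) - F (p k)).
    by rewrite telescope_sumr// pn /p mulr0n addr0.
  apply: (le_trans (ler_norm_sum _ _ _)).
  apply: (@le_trans _ _ (\sum_(0 <= k < n) K * h ^+ 2)).
    rewrite !big_nat; apply: ler_sum => k /andP[_ kn].
    have -> : h = p k.+1 - p k by rewrite /p mulrSr addrA [_ + h]addrC addrK.
    have pS i : p i <= p i.+1 by rewrite /p lerD2l mulrSr lerDl.
    apply: FK => //; first by rewrite /p lerDl mulrn_wge0.
    by rewrite -[leRHS]pn /p lerD2l ler_wpMn2l.
  rewrite sumr_const_nat subn0 -[leLHS]mulr_natr.
  suff -> : K * h ^+ 2 * n%:R = K * (b - a) ^+ 2 / n%:R by [].
  by rewrite -mulrA expr2 -mulrA /h divfK ?gt_eqF// mulrAC -expr2 mulrA.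
(* If the constant is nonpositive, one piece suffices; otherwise the Archimedean property gives a
   number of pieces beyond K (b - a)^2 / e. *)
have [K0|K0] := leP (K * (b - a) ^+ 2) 0.
  apply: (le_trans (sumle 1 _)) => //; rewrite divr1; lra.
have := @archi_boundP R (K * (b - a) ^+ 2 / e) (ltW (divr_gt0 K0 e0)).
set N := Num.bound _ => KN.
have N0 : 0 < N%:R :> R by rewrite (lt_trans _ KN)// divr_gt0.
apply: (le_trans (sumle N _)); first by move: N0; rewrite ltr0n.
by rewrite ler_pdivrMr// [leRHS]mulrC -ler_pdivrMr// ltW.
Qed.

(** Increments stand in for the equation F' = f, so [f] may be discontinuous; its boundedness makes
    [F] Lipschitz. *)
Definition primitive a b F f :=
  bounded_measurable a b f /\
  forall s t, a <= s -> s <= t -> t <= b ->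
    F t - F s = \int[mu]_(x in `[s, t]) f x.

Lemma primitiveS a b s t F f : a <= s -> t <= b ->
  primitive a b F f -> primitive s t F f.
Proof.
move=> as_ tb [bf Ff]; split; first exact: bounded_measurableS bf.
by move=> s' t' *; apply: Ff; lra.
Qed.

Lemma primitive_lipschitz a b F f : primitive a b F f ->
  exists2 K, 0 <= K & forall s t, s \in `[a, b] -> t \in `[a, b] ->
    `|F t - F s| <= K * `|t - s|.
Proof.
move=> [[mf [K K0 fK]] Ff]; exists K => // s t.
wlog st : s t / s <= t.
  move=> h sab tab; have [st|/ltW ts] := leP s t; first exact: h.
  by rewrite distrC (distrC t); exact: h.
rewrite !in_itv/= => /andP[as_ sb] /andP[at_ tb].
rewrite (ger0_norm (_ : 0 <= t - s)) ?subr_ge0// Ff//.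
apply: le_norm_Rintegral_itv => //.
  by apply: (bounded_measurableS as_ tb); split => //; exists K.
by move=> r; rewrite in_itv/= => /andP[? ?]; apply: fK; rewrite in_itv/=;
  apply/andP; split; lra.
Qed.

Lemma primitive_continuous a b F f : primitive a b F f ->
  {within `[a, b], continuous F}.
Proof.
move=> /primitive_lipschitz [K K0 FK]; apply/subspace_continuousP => s /= sab.
apply/cvgrPdist_le => e e0; rewrite near_withinE; near=> t => /= tab.
rewrite (le_trans (FK _ _ tab sab))//.
(* [K] may be 0; [K + 1] is safe to divide by. *)
rewrite (@le_trans _ _ ((K + 1) * `|s - t|)) ?ler_wpM2r ?lerDl//.
rewrite mulrC -ler_pdivlMr ?ltr_wpDl//; near: t.
by apply: cvgr_dist_le => //; rewrite divr_gt0// ltr_wpDl.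
Unshelve. all: by end_near. Qed.

Lemma primitive_bounded_measurable a b F f : primitive a b F f ->
  bounded_measurable a b F.
Proof.
by move=> /primitive_continuous; exact: continuous_bounded_measurable.
Qed.

Lemma quadratic_error_primitive a b K F f : bounded_measurable a b f ->
  (forall s t, a <= s -> s <= t -> t <= b ->
    `|F t - F s - \int[mu]_(x in `[s, t]) f x| <= K * (t - s) ^+ 2) ->
  primitive a b F f.
Proof.
move=> bf FK; split => // s t as_ st tb.
(* By additivity of the integral, the increments of [H] are exactly the errors in the hypothesis, so
   [H] is constant on [s, t]. *)
pose H r := F r - \int[mu]_(x in `[s, r]) f x.
have : H s = H t.
  apply: (@quadratic_increments_eq _ _ K) => // s1 t1 ss1 st1 tt1.
  rewrite /H (@Rintegral_split _ s t1 s1) ?ss1//; last first.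
    by apply: bounded_measurableS bf; lra.
  set I1 := \int[mu]_(x in `[s, s1]) f x; set I2 := \int[mu]_(x in `[s1, t1]) f x.
  rewrite (_ : _ - _ = F t1 - F s1 - I2); last by ring.
  by apply: FK; lra.
by rewrite /H set_itv1 Rintegral_set1 subr0 => ->; lra.
Qed.

End primitive.

(** * Product and exponential rules for indefinite integrals *)

Section primitive_calculus.
Context {R : realType}.
Notation mu := (@lebesgue_measure R).
Implicit Types (a b c s t K : R) (f g F G : R -> R).

Lemma primitive_cst_linear a b c d : primitive a b (fun s => c * s + d) (cst c).
Proof.
split; first exact: bounded_measurable_cst.
move=> s t as_ st tb; rewrite Rintegral_cst//= lebesgue_measure_itv/= lte_fin.
have [_|ts] := ltP s t => /=; first by ring.
by rewrite (_ : s = t); [ring|lra].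
Qed.

Lemma primitiveB a b F G f g : primitive a b F f -> primitive a b G g ->
  primitive a b (fun s => F s - G s) (fun s => f s - g s).
Proof.
move=> [bf Ff] [bg Gg]; split; first exact: bounded_measurableB.
move=> s t as_ st tb.
rewrite RintegralB//; first by rewrite -Ff// -Gg//; lra.
- by apply: bounded_measurable_integrable; exact: bounded_measurableS bf.
- by apply: bounded_measurable_integrable; exact: bounded_measurableS bg.
Qed.

(** With [G] frozen at t and [F] frozen at s, the increment of the product is an exact integral.
    Unfreezing changes the integrand by O(t - s), hence the integral by O((t - s)^2). *)
Lemma primitiveM a b F G f g : primitive a b F f -> primitive a b G g ->
  primitive a b (fun s => F s * G s) (fun s => f s * G s + F s * g s).
Proof.
move=> Ff Gg.
have [[bf intf] [bg intg]] := (Ff, Gg).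
have bF := primitive_bounded_measurable Ff.
have bG := primitive_bounded_measurable Gg.
have [K1 K10 FK] := primitive_lipschitz Ff.
have [K2 K20 GK] := primitive_lipschitz Gg.
have [[_ [M1 M10 fM]] [_ [M2 M20 gM]]] := (bf, bg).
pose K := K1 * M2 + K2 * M1.
apply: (@quadratic_error_primitive _ _ _ K).
  by apply: bounded_measurableD; apply: bounded_measurableM.
move=> s t as_ st tb.
have bS h : bounded_measurable a b h -> mu.-integrable `[s, t] (EFin \o h).
  by move=> bh; apply: bounded_measurable_integrable; exact: bounded_measurableS bh.
have -> : F t * G t - F s * G s =
    \int[mu]_(x in `[s, t]) (f x * G t + F s * g x).
  rewrite RintegralD//; last 2 first.
  - by apply: bS; apply: bounded_measurableM => //; exact: bounded_measurable_cst.
  - by apply: bS; apply: bounded_measurableM => //; exact: bounded_measurable_cst.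
  rewrite RintegralZr//; last exact: bS.
  rewrite RintegralZl//; last exact: bS.
  by rewrite -intf// -intg//; ring.
rewrite -RintegralB//; last 2 first.
- by apply: bS; apply: bounded_measurableD; apply: bounded_measurableM => //;
    exact: bounded_measurable_cst.
- by apply: bS; apply: bounded_measurableD; apply: bounded_measurableM.
apply: le_trans (le_norm_Rintegral_itv (K := K * (t - s)) _ _ _) _ => //.
- apply: (bounded_measurableS as_ tb).
  by apply: bounded_measurableB; apply: bounded_measurableD;
    apply: bounded_measurableM => //; exact: bounded_measurable_cst.
- move=> r; rewrite in_itv/= => /andP[sr rt].
  have itv x : s <= x -> x <= t -> x \in `[a, b].
    by move=> sx xt; rewrite in_itv/=; apply/andP; split; lra.
  (* Each term pairs a Lipschitz increment with a bounded density, whence the two summands of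
     [K]. *)
  have -> : f r * G t + F s * g r - (f r * G r + F r * g r) =
      f r * (G t - G r) + (F s - F r) * g r by ring.
  rewrite (le_trans (ler_normD _ _))// /K [leRHS]mulrDl [leLHS]addrC lerD//.
    rewrite normrM mulrAC ler_pM ?gM ?itv//.
    by rewrite (le_trans (FK _ _ _ _)) ?itv// ler_wpM2l// distrC ger0_norm; lra.
  rewrite normrM mulrC mulrAC ler_pM ?fM ?itv//.
  by rewrite (le_trans (GK _ _ _ _)) ?itv// ler_wpM2l// ger0_norm; lra.
- by rewrite expr2 mulrA.
Qed.

Lemma expR_above_tangent (x y : R) : (y - x) * expR x <= expR y - expR x.
Proof.
have := expR_ge1Dx (y - x); rewrite -(ler_pM2r (expR_gt0 x)) -expRD subrK.
by rewrite mulrDl mul1r; lra.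
Qed.

Lemma expR_lipschitz (x y M : R) : x <= M -> y <= M ->
  `|expR y - expR x| <= expR M * `|y - x|.
Proof.
wlog xy : x y / x <= y.
  move=> h xM yM; have [xy|/ltW yx] := leP x y; first exact: h.
  by rewrite distrC (distrC y); exact: h.
move=> xM yM; rewrite !ger0_norm ?subr_ge0// ?ler_expR//.
have := expR_above_tangent y x.
have : (y - x) * expR y <= (y - x) * expR M by rewrite ler_wpM2l ?subr_ge0 ?ler_expR.
by lra.
Qed.

(** By convexity, the tangents at x and at y place the remainder between 0 and (y - x)(exp y - exp
    x); the Lipschitz bound concludes. *)
Lemma expR_second_order (x y M : R) : x <= M -> y <= M ->
  `|expR y - expR x - (y - x) * expR x| <= expR M * (y - x) ^+ 2.
Proof.
move=> xM yM; have h1 := expR_above_tangent x y.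
have h2 := expR_above_tangent y x.
rewrite ger0_norm; last lra.
apply: (@le_trans _ _ ((y - x) * (expR y - expR x))); first by rewrite mulrBr; lra.
rewrite -(real_normK (num_real (y - x))) expr2 mulrA [leRHS]mulrC.
rewrite (le_trans (ler_norm _))// normrM ler_wpM2l//.
exact: expR_lipschitz.
Qed.

Lemma primitive_expR a b F f : primitive a b F f ->
  primitive a b (fun s => expR (F s)) (fun s => f s * expR (F s)).
Proof.
move=> Ff; have [bf intf] := Ff.
have bF := primitive_bounded_measurable Ff.
have [K1 K10 FK] := primitive_lipschitz Ff.
have [[_ [M M0 fM]] [_ [N N0 FN]]] := (bf, bF).
have be := bounded_measurable_expR bF.
pose K := expR N * K1 ^+ 2 + M * (expR N * K1).
apply: (@quadratic_error_primitive _ _ _ K).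
  exact: bounded_measurableM.
move=> s t as_ st tb.
have itv x : s <= x -> x <= t -> x \in `[a, b].
  by move=> sx xt; rewrite in_itv/=; apply/andP; split; lra.
have bS h : bounded_measurable a b h -> mu.-integrable `[s, t] (EFin \o h).
  by move=> bh; apply: bounded_measurable_integrable; exact: bounded_measurableS bh.
have FleN x : s <= x -> x <= t -> F x <= N.
  by move=> sx xt; rewrite (le_trans (ler_norm _)) ?FN ?itv.
(* Two quadratic errors: the Taylor remainder of the exponential between [F s] and [F t], and the
   cost of freezing [expR (F x)] at s in the integral. *)
have -> : expR (F t) - expR (F s) - \int[mu]_(x in `[s, t]) (f x * expR (F x)) =
    (expR (F t) - expR (F s) - (F t - F s) * expR (F s)) +
    \int[mu]_(x in `[s, t]) (f x * (expR (F s) - expR (F x))).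
  under [in RHS]eq_Rintegral do rewrite mulrBr.
  rewrite [in RHS]RintegralB//; last 2 first.
  - by apply: bS; apply: bounded_measurableM => //; exact: bounded_measurable_cst.
  - by apply: bS; exact: bounded_measurableM.
  rewrite RintegralZr//; last exact: bS.
  by rewrite -intf//; ring.
have st0 : 0 <= t - s by rewrite subr_ge0.
rewrite (le_trans (ler_normD _ _))// /K [leRHS]mulrDl lerD//.
  rewrite (le_trans (expR_second_order (M := N) _ _))// ?FleN//.
  rewrite -mulrA ler_wpM2l ?expR_ge0// -exprMn -(real_normK (num_real _)).
  rewrite lerXn2r ?nnegrE ?mulr_ge0//.
  by rewrite -[leRHS](_ : K1 * `|t - s| = _) ?FK ?itv// ger0_norm.
apply: le_trans (le_norm_Rintegral_itv (K := M * (expR N * (K1 * (t - s)))) _ _ _) _ => //.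
- apply: (bounded_measurableS as_ tb); apply: bounded_measurableM => //.
  by apply: bounded_measurableB => //; exact: bounded_measurable_cst.
- move=> r; rewrite in_itv/= => /andP[sr rt].
  rewrite normrM ler_pM ?fM ?itv//.
  rewrite (le_trans (expR_lipschitz (M := N) _ _)) ?FleN//.
  rewrite ler_wpM2l ?expR_ge0// (le_trans (FK _ _ _ _)) ?itv//.
  by rewrite ler_wpM2l// distrC ger0_norm; lra.
- by rewrite expr2 !mulrA.
Qed.

End primitive_calculus.

(** * From difference quotients within [a, b] to the fundamental theorem of calculus *)

Section one_sided_derivative.
Context {R : realType}.
Notation mu := (@lebesgue_measure R).
Implicit Types (a b s t l : R) (g d : R -> R).

Lemma diff_quot_cvg_continuous a b g t l :
  diff_quot g t @ within `[a, b] t^' --> l ->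
  g @ within `[a, b] (nbhs t) --> g t.
Proof.
move=> gl.
have gt : g @ within `[a, b] t^' --> g t.
  (* Away from t this function is [g], and its second term tends to l * 0. *)
  have : (fun s => g t + diff_quot g t s * (s - t)) @ within `[a, b] t^' --> g t.
    rewrite -[X in _ --> X]addr0 -(mulr0 l) -(subrr t).
    apply: cvgD; first exact: cvg_cst.
    apply: cvgM => //; apply: cvgB; last exact: cvg_cst.
    by apply: cvg_within_filter; exact: nbhs_dnbhs.
  apply: cvg_trans; apply: near_eq_cvg; rewrite near_withinE.
  near=> s => _; have st : s != t by near: s; exact: nbhs_dnbhs_neq.
  by rewrite /diff_quot divfK ?subr_eq0// addrC subrK.
apply/cvgrPdist_le => e e0; rewrite near_withinE.
move/cvgrPdist_le : gt => /(_ _ e0); rewrite near_withinE.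
rewrite /dnbhs near_withinE; apply: filterS => s /= h sab.
by have [->|/h] := eqVneq s t; [rewrite subrr normr0 ltW|exact].
Unshelve. all: by end_near. Qed.

Lemma diff_quot_within_continuous a b g d :
  (forall t, t \in `[a, b] -> diff_quot g t @ within `[a, b] t^' --> d t) ->
  {within `[a, b], continuous g}.
Proof.
move=> gd; apply/subspace_continuousP => t tab.
exact: diff_quot_cvg_continuous (gd t tab).
Qed.

Lemma diff_quot_is_derive a b g t l : a < t < b ->
  diff_quot g t @ within `[a, b] t^' --> l -> is_derive t 1 g l.
Proof.
move=> /andP[at_ tb] gl; apply/is_derive1_caratheodory.
(* Caratheodory slope function; its continuity at the interior point t holds because [a, b] is a
   neighbourhood of t. *)
exists (fun z => if z == t then l else diff_quot g t z); split.
- move=> z; have [->|zt] := eqVneq z t; first by rewrite !subrr mulr0.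
  by rewrite /diff_quot divfK// subr_eq0.
- apply/cvgrPdist_le => e e0 /=; rewrite eqxx.
  move/cvgrPdist_le : gl => /(_ _ e0); rewrite near_withinE.
  rewrite /dnbhs near_withinE => h; near=> z.
  have [_|zt] := eqVneq z t; first by rewrite subrr normr0 ltW.
  have : z \in `[a, b].
    rewrite in_itv/=; apply/andP; split; apply: ltW; near: z.
      exact: lt_nbhsr.
    exact: lt_nbhsl.
  by move: zt; near: z.
- by rewrite eqxx.
Unshelve. all: by end_near. Qed.

(** The fundamental theorem on [s, t] uses two-sided derivatives inside ]s, t[ and one-sided
    continuity of [g] at the ends; both follow from the quotients. *)
Lemma diff_quot_primitive a b g d :
  (forall t, t \in `[a, b] -> diff_quot g t @ within `[a, b] t^' --> d t) ->
  {within `[a, b], continuous d} -> primitive a b g d.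
Proof.
move=> gd cd; split; first exact: continuous_bounded_measurable.
move=> s t as_; rewrite le_eqVlt => /predU1P[->|st] tb.
  by rewrite subrr set_itv1 Rintegral_set1.
have sub : `[s, t] `<=` `[a, b].
  by move=> r /=; rewrite !in_itv/= => /andP[? ?]; apply/andP; split; lra.
have isd r : r \in `]s, t[ -> is_derive r 1 g (d r).
  rewrite in_itv/= => /andP[sr rt]; apply: (@diff_quot_is_derive a b).
    by apply/andP; split; lra.
  by apply: gd; rewrite in_itv/=; apply/andP; split; lra.
have cg : {within `[s, t], continuous g}.
  by apply: continuous_subspaceW sub _; exact: diff_quot_within_continuous gd.
have [_ gs gt] := (continuous_within_itvP g st).1 cg.
rewrite /Rintegral (@continuous_FTC2 _ d g)//.
- exact: continuous_subspaceW sub cd.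
- by split => // r /isd /@ex_derive.
- by move=> r /isd rd; rewrite derive1E derive_val.
Qed.

End one_sided_derivative.

(** * Vector fields and their partial derivatives along a curve *)

Section vector_fields.
Context {R : realType} {m : nat}.
Notation mu := (@lebesgue_measure R).
Implicit Types (a b t L : R) (v : R -> 'rV[R]_m) (g : 'rV[R]_m -> R)
  (phi : R -> 'rV[R]_m -> R).

Lemma cvg_rV (T : Type) (F : set_system T) (w : T -> 'rV[R]_m) (l : 'rV[R]_m) :
  Filter F -> (forall j, (fun y => w y 0 j) @ F --> l 0 j) -> w @ F --> l.
Proof.
move=> FF wl A [P lP PA].
have : \forall y \near F, forall j, P 0 j (w y 0 j).
  by apply: filter_forall => j; exact: wl.
by apply: filterS => y Py; apply: PA => i j; rewrite ord1.
Qed.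

Lemma continuous_along a b phi v :
  {within `[a, b] `*` [set: 'rV[R]_m], continuous (fun p => phi p.1 p.2)} ->
  (forall j, {within `[a, b], continuous (fun t => v t 0 j)}) ->
  {within `[a, b], continuous (fun t => phi t (v t))}.
Proof.
move=> /subspace_continuousP cphi cv; apply/subspace_continuousP => t tab.
apply: (@cvg_comp _ _ _ (fun s => (s, v s)) (fun p => phi p.1 p.2) _
  (within (`[a, b] `*` [set: 'rV[R]_m]) (nbhs (t, v t)))); last first.
  by apply: (cphi (t, v t)); split.
have cpair : (fun s => (s, v s)) @ within `[a, b] (nbhs t) --> (t, v t).
  have cvt : v @ within `[a, b] (nbhs t) --> v t.
    by apply: cvg_rV => j; have /subspace_continuousP := cv j; exact.
  have cid : id @ within `[a, b] (nbhs t) --> t by exact: cvg_within.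
  exact: cvg_pair cid cvt.
(* Besides converging to (t, v t), the pairs (s, v s) must stay in the strip where [phi] is
   continuous; s in [a, b] ensures it. *)
move=> A hA.
have hB : nbhs t (fun s => `[a, b]%classic s ->
  (`[a, b] `*` [set: 'rV[R]_m]) (s, v s) -> A (s, v s)) := cpair _ hA.
change (nbhs t (fun s => `[a, b]%classic s -> A (s, v s))).
by apply: filterS hB => s h sab; apply: h.
Qed.

(** Taking the steps 1/(k + 1) turns the partial derivative into a limit of a sequence, through
    which measurability passes. *)
Lemma partial_quot_cvg j g x : has_partial j g ->
  (fun k => k.+1%:R * (g (k.+1%:R^-1 *: basis_vec R j + x) - g x)) @ \oo
    --> partial j g x.
Proof.
move=> /(_ x) dg.
have h0 : (fun k => k.+1%:R^-1 : R) @ \oo --> (0 : R)^'.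
  move=> A A0.
  have hA : \forall k \near \oo, harmonic k != 0 :> R -> A (harmonic k) :=
    @cvg_harmonic R _ A0.
  change (\forall k \near \oo, A (harmonic k)).
  by apply: filterS hA => k; apply; rewrite gt_eqF ?harmonic_gt0.
have := cvg_comp _ _ h0 dg.
by apply: cvg_trans; apply: near_eq_cvg; near=> k; rewrite /= invrK.
Unshelve. all: by end_near. Qed.

(** A step along [basis_vec R j] changes only coordinate j, so every difference quotient is bounded
    by [L], and so is the limit. *)
Lemma partial_bound j g x L :
  (forall y z, `|g y - g z| <= L * \sum_(k < m) `|y 0 k - z 0 k|) ->
  has_partial j g -> `|partial j g x| <= L.
Proof.
move=> gL dg; have /cvg_norm gx := partial_quot_cvg (x := x) dg.
apply: (cvgr_to_le gx); near=> k.
rewrite normrM ger0_norm// (le_trans (ler_wpM2l _ (gL _ _)))//.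
rewrite (bigD1 j)//= big1 ?addr0 => [|i /negPf ij]; last first.
  by rewrite !mxE eqxx ij mulr0 add0r subrr normr0.
rewrite !mxE !eqxx mulr1 addrK ger0_norm ?invr_ge0//.
by rewrite mulrCA mulfV ?mulr1.
Unshelve. all: by end_near. Qed.

(** Along the curve the difference quotients are continuous in t, so their pointwise limit is
    measurable; the Lipschitz constant bounds it. *)
Lemma partial_along_bounded_measurable a b phi v j L : 0 <= L ->
  {within `[a, b] `*` [set: 'rV[R]_m], continuous (fun p => phi p.1 p.2)} ->
  (forall t, t \in `[a, b] -> has_partial j (phi t)) ->
  (forall t y z, t \in `[a, b] ->
    `|phi t y - phi t z| <= L * \sum_(k < m) `|y 0 k - z 0 k|) ->
  (forall k, {within `[a, b], continuous (fun t => v t 0 k)}) ->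
  bounded_measurable a b (fun t => partial j (phi t) (v t)).
Proof.
move=> L0 cphi dphi phiL cv; split; last first.
  exists L => // t tab; apply: partial_bound; last exact: dphi.
  by move=> y z; exact: phiL.
pose q (k : nat) t :=
  k.+1%:R * (phi t (k.+1%:R^-1 *: basis_vec R j + v t) - phi t (v t)).
apply: (@measurable_fun_cvg _ _ _ _ q) => [k|t tab]; last first.
  by apply: partial_quot_cvg; exact: dphi.
apply: subspace_continuous_measurable_fun => //.
move=> t; apply: cvgM; first exact: cvg_cst.
apply: cvgB; last exact: (continuous_along cphi cv).
apply: (@continuous_along a b phi (fun t => _ + v t)) => // i.
rewrite [X in continuous X](_ : _ = fun t =>
  (k.+1%:R^-1 *: basis_vec R j) 0 i + v t 0 i).
  by move=> s; apply: cvgD; [exact: cvg_cst|exact: cv].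
by apply/funext => s; rewrite /from_subspace [LHS]mxE.
Qed.

End vector_fields.

(** * Error estimate for one correction of one component *)

Section correction_step.
Context {R : realType}.
Notation mu := (@lebesgue_measure R).
Implicit Types (a b c s t K L beta : R) (f g F G d e alpha rho : R -> R).

Lemma RintegralN_itv a b f : bounded_measurable a b f ->
  \int[mu]_(x in `[a, b]) (- f x) = - \int[mu]_(x in `[a, b]) f x.
Proof.
move=> bf; rewrite -mulN1r -RintegralZl//; last exact: bounded_measurable_integrable.
by apply: eq_Rintegral => s _; rewrite mulN1r.
Qed.

(** This serves the exponent of the multiplier, whose variable is the lower limit of integration;
    hence the minus sign. *)
Lemma upper_integral_primitive a b f : bounded_measurable a b f ->
  primitive a b (fun s => \int[mu]_(x in `[s, b]) f x) (fun s => - f s).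
Proof.
move=> bf; split; first exact: bounded_measurableN.
move=> s t as_ st tb.
rewrite RintegralN_itv; last exact: bounded_measurableS bf.
rewrite (@Rintegral_split _ s b t) ?st//; last by apply: bounded_measurableS bf.
by rewrite opprD addrCA subrr addr0.
Qed.

(* The multiplier solves the adjoint of the equation linearized in the
   diagonal variable, so integrating by parts trades [d] for [d - alpha e]. *)
Lemma variation_of_constants a b e d alpha : a <= b ->
  primitive a b e d -> e a = 0 -> bounded_measurable a b alpha ->
  e b = \int[mu]_(s in `[a, b])
    (expR (\int[mu]_(r in `[s, b]) alpha r) * (d s - alpha s * e s)).
Proof.
move=> ab ed ea balpha.
have [_ /(_ a b (lexx a) ab (lexx b))] :=
  primitiveM (primitive_expR (upper_integral_primitive balpha)) ed.
have -> : \int[mu]_(r in `[b, b]) alpha r = 0.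
  by rewrite set_itv1 Rintegral_set1.
rewrite ea (mulr0 (expR _)) subr0 expR0 mul1r => ->.
by apply: eq_Rintegral => s _; ring.
Qed.

(** The majorant is the derivative of c exp(beta (s - a)), so its integral is explicit. *)
Lemma Rintegral_expR_le a b c beta f : a <= b -> bounded_measurable a b f ->
  (forall s, s \in `[a, b] -> `|f s| <= c * (beta * expR (beta * (s - a)))) ->
  `|\int[mu]_(s in `[a, b]) f s| <= c * (expR (beta * (b - a)) - 1).
Proof.
move=> ab bf fle.
have pE := primitive_expR (primitive_cst_linear a b beta (- (beta * a))).
have bE : bounded_measurable a b (fun s => beta * expR (beta * s + - (beta * a))).
  by have [] := pE.
have bcE : bounded_measurable a b
    (fun s => c * (beta * expR (beta * s + - (beta * a)))).
  by apply: bounded_measurableM bE; exact: bounded_measurable_cst.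
have intE : c * (expR (beta * (b - a)) - 1) =
    \int[mu]_(s in `[a, b]) (c * (beta * expR (beta * s + - (beta * a)))).
  rewrite RintegralZl//; last exact: bounded_measurable_integrable.
  have [_ /(_ a b)] := pE; rewrite !lexx ab => <- //.
  by rewrite subrr expR0 -mulrBr.
rewrite intE; apply: (le_trans (le_normr_Rintegral _ _)) => //.
  exact: bounded_measurable_integrable.
apply: le_Rintegral => //.
- by apply: bounded_measurable_integrable; exact: bounded_measurable_norm.
- exact: bounded_measurable_integrable.
- by move=> s sab; rewrite -mulrBr; exact: fle.
Qed.

(** Here [e] is the old error with density [d], [rho] the residual of the iterate, and the left side
    the new error at b. Only [d - rho], a difference of two values of the field, survives the
    integration by parts. Integrating the weight yields the gain 1 / beta. *)
Lemma corrected_error_le a b c beta L e d alpha rho : a <= b -> 0 <= L ->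
  0 < beta -> primitive a b e d -> e a = 0 ->
  bounded_measurable a b alpha -> bounded_measurable a b rho ->
  (forall s, s \in `[a, b] -> `|alpha s| <= L) ->
  (forall s, s \in `[a, b] -> `|e s| <= c * expR (beta * (s - a))) ->
  (forall s, s \in `[a, b] ->
    `|d s - rho s| <= L * (c * expR (beta * (s - a)))) ->
  `|e b + \int[mu]_(s in `[a, b])
      (- expR (\int[mu]_(r in `[s, b]) alpha r) * rho s)| <=
    2 * L * expR (L * (b - a)) * c / beta * (expR (beta * (b - a)) - 1).
Proof.
move=> ab L0 beta0 ed ea balpha brho alphaL ele drho.
have bX := bounded_measurable_expR
  (primitive_bounded_measurable (upper_integral_primitive balpha)).
have be := primitive_bounded_measurable ed; have [bd _] := ed.
have bh : bounded_measurable a b (fun s =>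
    expR (\int[mu]_(r in `[s, b]) alpha r) * (d s - rho s - alpha s * e s)).
  apply: bounded_measurableM bX _; apply: bounded_measurableB.
    exact: bounded_measurableB.
  exact: bounded_measurableM.
have -> : e b + \int[mu]_(s in `[a, b])
      (- expR (\int[mu]_(r in `[s, b]) alpha r) * rho s) =
    \int[mu]_(s in `[a, b]) (expR (\int[mu]_(r in `[s, b]) alpha r) *
      (d s - rho s - alpha s * e s)).
  rewrite [in LHS](variation_of_constants ab ed ea balpha) -RintegralD//.
  - by apply: eq_Rintegral => s _; ring.
  - apply: bounded_measurable_integrable; apply: bounded_measurableM bX _.
    by apply: bounded_measurableB => //; exact: bounded_measurableM.
  - apply: bounded_measurable_integrable; apply: bounded_measurableM => //.
    exact: bounded_measurableN.
apply: Rintegral_expR_le => // s sab.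
have c0 : 0 <= c * expR (beta * (s - a)) by apply: le_trans (ele s sab).
have Xle : expR (\int[mu]_(r in `[s, b]) alpha r) <= expR (L * (b - a)).
  have [as_ sb] : a <= s /\ s <= b by move: sab; rewrite in_itv/= => /andP.
  rewrite ler_expR (le_trans (ler_norm _))//.
  apply: (@le_trans _ _ (L * (b - s))); last by rewrite ler_wpM2l//; lra.
  apply: le_norm_Rintegral_itv => //; first exact: bounded_measurableS balpha.
  move=> r; rewrite in_itv/= => /andP[sr rb]; apply: alphaL.
  by rewrite in_itv/=; apply/andP; split; lra.
(* The factor 2 splits into one share for [d - rho] and one for [alpha * e]. *)
have -> : 2 * L * expR (L * (b - a)) * c / beta *
      (beta * expR (beta * (s - a))) =
    expR (L * (b - a)) * (L * (c * expR (beta * (s - a))) +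
      L * (c * expR (beta * (s - a)))).
  by field; rewrite gt_eqF.
rewrite normrM ger0_norm ?expR_ge0// ler_pM ?expR_ge0//.
rewrite (le_trans (ler_normB _ _))// lerD ?drho// normrM.
by rewrite ler_pM ?alphaL ?ele.
Qed.

End correction_step.

(** * The supremum norm and the geometric decay of the error *)

Lemma norm_sup_le (R : realType) (m : nat) (a b K : R) (v : R -> 'rV[R]_m) :
  a <= b -> (forall t, t \in `[a, b] -> norm1 (v t) <= K) ->
  0 <= norm_sup a b v <= K.
Proof.
move=> ab vK; pose S := [set norm1 (v t) | t in `[a, b]].
have Sa : S (norm1 (v a)) by exists a => //=; rewrite in_itv/= lexx.
have SK : ubound S K by move=> _ [t tab <-]; exact: vK.
(* The lower bound, needed for squeezing, comes from the value at [a], which [sup] dominates since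
   [K] bounds the set. *)
apply/andP; split; last by apply: ge_sup => //; exists (norm1 (v a)).
apply: le_trans (ub_le_sup _ Sa); last by exists K.
exact: sumr_ge0.
Qed.

Theorem theorem3p1 (R : realType) (m : nat) (hm : (1 <= m)%N)
    (t0 tf : R) (ht : t0 < tf) (x0 : 'rV[R]_m)
    (f : 'I_m -> R -> 'rV[R]_m -> R)
    (f_cont : forall i : 'I_m,
      {within `[t0, tf] `*` [set: 'rV[R]_m],
        continuous (fun p : R * 'rV[R]_m => f i p.1 p.2)})
    (f_partial1 : forall (i j : 'I_m) (t : R), t \in `[t0, tf] ->
      has_partial j (f i t))
    (f_partial2 : forall (i j k : 'I_m) (t : R), t \in `[t0, tf] ->
      has_partial k (partial j (f i t)))
    (f_lipschitz : exists2 L : R, 0 < L &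
      forall (i : 'I_m) (t : R) (x y : 'rV[R]_m), t \in `[t0, tf] ->
        `|f i t x - f i t y| <= L * \sum_(j < m) `|x 0 j - y 0 j|)
    (x : R -> 'rV[R]_m)
    (x_init : x t0 = x0)
    (x_derivable : forall i : 'I_m, derivable_on t0 tf (fun t => x t 0 i))
    (x_sol : forall (i : 'I_m) (t : R), t \in `[t0, tf] ->
      derive_on t0 tf (fun t => x t 0 i) t = f i t (x t))
    (u : nat -> R -> 'rV[R]_m)
    (u_C1 : forall (n : nat) (i : 'I_m), C1_on t0 tf (fun t => u n t 0 i))
    (u_init : forall (n : nat) (i : 'I_m), u n t0 0 i = x0 0 i)
    (u_iter : forall (n : nat) (i : 'I_m) (t : R), t \in `[t0, tf] ->
      u n.+1 t 0 i = u n t 0 i +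
        \int[lebesgue_measure]_(s in `[t0, t])
          (multiplier f (u n) i s t *
            (derive_on t0 tf (fun r => u n r 0 i) s - f i s (u n s)))) :
  (fun n : nat => norm_sup t0 tf (fun t => u n t - x t)) @ \oo --> (0 : R).
Proof.
have [L L0 fL] := f_lipschitz.
have T0 : 0 <= tf - t0 by lra.
pose e n i t := u n t 0 i - x t 0 i.
pose d n i s := derive_on t0 tf (fun r => u n r 0 i) s - f i s (x s).
pose rho n i s := derive_on t0 tf (fun r => u n r 0 i) s - f i s (u n s).
pose alpha n i s := partial i (f i s) (u n s).
have cx i : {within `[t0, tf], continuous (fun t => x t 0 i)}.
  by apply: diff_quot_within_continuous => t; exact: x_derivable.
have cfx i : {within `[t0, tf], continuous (fun t => f i t (x t))}.
  exact: continuous_along.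
have px i : primitive t0 tf (fun t => x t 0 i) (fun t => f i t (x t)).
  (* The equation identifies the derivative of [x] with a function already known to be
     continuous. *)
  apply: diff_quot_primitive => // t tab; rewrite -x_sol//.
  exact: x_derivable.
have pu n i : primitive t0 tf (fun t => u n t 0 i)
    (derive_on t0 tf (fun t => u n t 0 i)).
  by have [du cu] := u_C1 n i; apply: diff_quot_primitive.
have cu n i := primitive_continuous (pu n i).
have pe n i : primitive t0 tf (e n i) (d n i) by exact: primitiveB.
have ea n i : e n i t0 = 0 by rewrite /e u_init x_init subrr.
have brho n i : bounded_measurable t0 tf (rho n i).
  apply: bounded_measurableB; first by have [] := pu n i.
  by apply: continuous_bounded_measurable; exact: continuous_along.
have balpha n i : bounded_measurable t0 tf (alpha n i).
  apply: (@partial_along_bounded_measurable _ _ _ _ _ _ _ L) => //.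
  - exact: ltW.
  - by move=> t tab; exact: f_partial1.
  - by move=> t y z tab; exact: fL.
have alphaL n i s : s \in `[t0, tf] -> `|alpha n i s| <= L.
  move=> sab; apply: partial_bound; last exact: f_partial1.
  by move=> y z; exact: fL.
have eE n t : norm1 (u n t - x t) = \sum_(j < m) `|e n j t|.
  by apply: eq_bigr => j _; rewrite !mxE.
have [M M0 eM] : exists2 M, 0 <= M &
    forall t, t \in `[t0, tf] -> norm1 (u 0 t - x t) <= M.
  have [_ [M M0 eM]] : bounded_measurable t0 tf (fun t => \sum_(j < m) `|e 0 j t|).
    apply: bounded_measurable_sum => j; apply: bounded_measurable_norm.
    exact: primitive_bounded_measurable (pe 0 j).
  by exists M => // t tab; rewrite eE (le_trans (ler_norm _))// eM.
pose C := 2 * L * expR (L * (tf - t0)).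
have C0 : 0 < C by rewrite /C mulr_gt0 ?expR_gt0// mulr_gt0.
have m0 : 0 < m%:R :> R by rewrite ltr0n.
(* With this choice C / beta = 1 / (2 m): each component contributes that factor, and the sum over m
   components halves the error. *)
pose beta := 2 * m%:R * C.
have beta0 : 0 < beta by rewrite /beta mulr_gt0// mulr_gt0.
have bound n t : t \in `[t0, tf] ->
    norm1 (u n t - x t) <= M / 2 ^+ n * expR (beta * (t - t0)).
  elim: n t => [|n ih] t tab.
    have [t0t _] : t0 <= t /\ t <= tf by move: tab; rewrite in_itv/= => /andP.
    rewrite expr0 divr1 (le_trans (eM _ tab))// ler_peMr//.
    by rewrite -expR0 ler_expR mulr_ge0 ?(ltW beta0) ?subr_ge0.
  have [t0t ttf] : t0 <= t /\ t <= tf by move: tab; rewrite in_itv/= => /andP.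
  have sub s : s \in `[t0, t] -> s \in `[t0, tf].
    by rewrite !in_itv/= => /andP[? ?]; apply/andP; split; lra.
  pose c := M / 2 ^+ n.
  have c0 : 0 <= c by rewrite divr_ge0// exprn_ge0.
  have step i : `|e n.+1 i t| <= c / (2 * m%:R) * expR (beta * (t - t0)).
    (* The new error is the old one plus the correction integral. Its multiplier ends at t, so the
       estimate is applied on [t0, t]. *)
    rewrite /e u_iter// addrAC -/(e n i t).
    apply: le_trans (corrected_error_le (c := c) (L := L) (beta := beta)
      (d := d n i) (alpha := alpha n i) _ _ _ _ _ _ _ _ _ _) _ => //.
    - exact: ltW.
    - exact: primitiveS (pe n i).
    - exact: bounded_measurableS (balpha n i).
    - exact: bounded_measurableS (brho n i).
    - by move=> s /sub; exact: alphaL.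
    - move=> s /sub sab; apply: le_trans (ih s sab).
      by rewrite eE (bigD1 i)//= lerDl sumr_ge0.
    - move=> s /sub sab; rewrite /d /rho.
      have -> : d n i s - rho n i s = f i s (u n s) - f i s (x s).
        by rewrite /d /rho; ring.
      apply: le_trans (fL _ _ _ _ sab) _; rewrite ler_wpM2l ?(ltW L0)//.
      apply: le_trans (ih s sab); apply: ler_sum => j _.
      by rewrite !mxE.
    (* Lengthening t - t0 to tf - t0 in the first exponential gives [C]; the subtracted 1 is
       dropped. [E1] gives the sign needed to multiply the bounds. *)
    - have E1 : 1 <= expR (beta * (t - t0)).
        by rewrite -expR0 ler_expR mulr_ge0 ?(ltW beta0) ?subr_ge0.
      have -> : c / (2 * m%:R) = C * c / beta.
        by rewrite /beta; field; rewrite !gt_eqF.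
      have b0 : 0 <= beta^-1 by rewrite invr_ge0 ltW.
      apply: ler_pM; [|by rewrite subr_ge0| |by rewrite gerBl].
        by rewrite !mulr_ge0 ?expR_ge0// ltW.
      rewrite ler_wpM2r// ler_wpM2r// ler_wpM2l ?mulr_ge0 ?(ltW L0)//.
      by rewrite ler_expR ler_wpM2l ?(ltW L0)//; lra.
  rewrite eE (le_trans (ler_sum _ (fun i _ => step i)))//.
  rewrite sumr_const card_ord -[leLHS]mulr_natl.
  rewrite [leLHS](_ : _ = M / 2 ^+ n.+1 * expR (beta * (t - t0)))//.
  rewrite /c exprSr; field.
  by rewrite (gt_eqF m0) expf_neq0.
(* Replacing the weight by its value at [tf] makes the bound uniform in t, which removes the weight
   from the norm. *)
have cvg0 : (fun n => M * expR (beta * (tf - t0)) * (2^-1) ^+ n) @ \oo --> (0 : R).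
  by apply: cvg_geometric; rewrite ger0_norm; lra.
apply: (squeeze_cvgr _ (cvg_cst 0) cvg0); near=> n.
apply: norm_sup_le => [|t tab]; first exact: ltW.
rewrite (le_trans (bound n t tab))// exprVn mulrAC ler_wpM2r ?invr_ge0 ?exprn_ge0//.
rewrite ler_wpM2l// ler_expR ler_wpM2l ?(ltW beta0)//.
by move: tab; rewrite in_itv/= => /andP[_]; lra.
Unshelve. all: by end_near. Qed.
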